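(* Let $k$ be a field and let $G$ be an almost Cohen-Macaulay bipartite graph (over $k$). Let $u$ be a vertex of degree one of $G$ and let $v$ be its adjacent vertex. Then $G\setminus\{v\}$ is almost Cohen-Macaulay.
   Context: The graph $G$ is finite and simple (no loops, no multiple edges) and has no isolated vertices. For $W\subseteq V(G)$, $G\setminus W$ denotes the subgraph of $G$ obtained by removing all vertices of $W$ (and the edges incident to them); it may have isolated vertices, which are kept as vertices. For a graph $H$ (possibly with isolated vertices), let $R_H$ be the polynomial ring over the field $k$ whose variables are the vertices of $H$. The edge ideal $I(H)\subseteq R_H$ is generated by all monomials $ab$ with $\{a,b\}\in E(H)$. The graph $H$ is called almost Cohen-Macaulay (aCM) if $\operatorname{depth} R_H/I(H)\geq \dim R_H/I(H)-1$. *)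

(* Defs.v *)
From HB Require Import structures.
From mathcomp Require Import all_boot all_order all_algebra.
From mathcomp Require Import generic_quotient ring_quotient.
From mathcomp Require Import boolp classical_sets.
From mathcomp Require Import mpoly.

Set Implicit Arguments.
Unset Strict Implicit.
Unset Printing Implicit Defensive.

Import GRing.Theory.

Local Open Scope ring_scope.
Local Open Scope classical_set_scope.
Local Open Scope quotient_scope.

Record sgraph := SGraph {
  vertex :> finType;
  adj : rel vertex;
  adj_sym : ssrbool.symmetric adj;
  adj_irrefl : irreflexive adj
}.

Section Graphs.
Variable G : sgraph.

Definition neighbours (x : G) : {set G} := [set y | adj x y]%SET.

Definition degree (x : G) : nat := #|neighbours x|.

Definition no_isolated_vertex : Prop := forall x : G, (0 < degree x)%N.

Definition bipartite : Prop :=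
  exists A : {set G}, forall x y : G, adj x y -> (x \in A) != (y \in A).

Definition del_adj (W : {set G}) : rel {x : G | x \notin W} :=
  fun x y => adj (val x) (val y).

Lemma del_adj_sym (W : {set G}) : ssrbool.symmetric (del_adj (W := W)).
Proof. by move=> x y; exact: adj_sym. Qed.

Lemma del_adj_irrefl (W : {set G}) : irreflexive (del_adj (W := W)).
Proof. by move=> x; exact: adj_irrefl. Qed.

Definition del_vertices (W : {set G}) : sgraph :=
  SGraph (del_adj_sym (W := W)) (del_adj_irrefl (W := W)).

End Graphs.

(* Suprema in the extended natural numbers, with None standing for +oo; the
   sets below are nonempty, so the value Some 0 at set0 is never used. *)
Definition enat_sup (A : set nat) : option nat :=
  if `[< exists b, ubound A b >] then Some (supremum 0%N A) else None.

Definition enat_le (x y : option nat) : bool :=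
  match x, y with
  | _, None => true
  | None, Some _ => false
  | Some a, Some b => (a <= b)%N
  end.

Section CommutativeAlgebra.
Variable A : comNzRingType.

Definition gen_ideal (X : set A) : set A :=
  [set p | exists s : seq (A * A),
     (forall ag, ag \in s -> X ag.2) /\ p = \sum_(ag <- s) ag.1 * ag.2].

(* Properness is part of idealr_closed. *)
Definition prime_ideal (P : {pred A}) : Prop :=
  idealr_closed P /\ prime_idealr_closed P.

(* P_0 < P_1 < ... < P_n, a chain of length n. *)
Definition prime_chain (n : nat) (P : 'I_n.+1 -> {pred A}) : Prop :=
  (forall i, prime_ideal (P i)) /\
  (forall i j : 'I_n.+1, (i < j)%N ->
     {subset P i <= P j} /\ ~ {subset P j <= P i}).

Definition krull_dim : option nat :=
  enat_sup [set n | exists P : 'I_n.+1 -> {pred A}, prime_chain P].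

Definition regular_sequence (s : seq A) : Prop :=
  (forall i, (i < size s)%N -> forall a : A,
     gen_ideal [set` take i s] (s`_i * a) -> gen_ideal [set` take i s] a) /\
  ~ gen_ideal [set` s] 1.

Definition depth (m : set A) : option nat :=
  enat_sup [set n | exists s : seq A,
     [/\ size s = n, {in s, forall a, m a} & regular_sequence s]].

End CommutativeAlgebra.

Section EdgeIdeal.
Variables (k : fieldType) (H : sgraph).

(* The polynomial ring on the vertices of H, which are numbered by enum_rank. *)
Definition vertex_ring : comNzRingType := {mpoly k[#|H|]}.

Definition var (x : H) : vertex_ring := 'X_(enum_rank x).

Definition edge_monomials : set vertex_ring :=
  [set p | exists a b : H, adj a b /\ p = var a * var b].

Definition edge_ideal : {pred vertex_ring} :=
  fun p => `[< gen_ideal edge_monomials p >].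

Lemma edge_ideal_closed : idealr_closed edge_ideal.
Proof.
split.
- by apply/asboolP; exists [::]; split => //; rewrite big_nil.
- apply/negP => /asboolP[s [sE /(congr1 (meval (fun=> 0)))]].
  rewrite meval1 raddf_sum /= big1_seq => [/eqP|ag /andP[_ /sE]].
    by rewrite oner_eq0.
  move=> [a [b [_ ->]]].
  by rewrite rmorphM rmorphM /= !mevalXU !mulr0.
- move=> c u v /asboolP[s [sE ->]] /asboolP[t [tE ->]]; apply/asboolP.
  exists ([seq (c * ag.1, ag.2) | ag <- s] ++ t); split.
    move=> ag; rewrite mem_cat => /orP[/mapP[bg /sE ? ->]|/tE] //.
  rewrite big_cat big_map mulr_sumr; congr (_ + _).
  by apply: eq_bigr => ag _; rewrite mulrA.
Qed.

HB.instance Definition _ := isIdealr.Build vertex_ring edge_ideal edge_ideal_closed.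

Definition edge_ring : comNzRingType := {ideal_quot edge_ideal}.

(* The image in R_H / I(H) of the irrelevant maximal ideal of R_H. *)
Definition irrelevant_ideal : set edge_ring :=
  gen_ideal [set p | exists x : H, p = \pi_{ideal_quot edge_ideal} (var x)].

(* depth R_H / I(H) >= dim R_H / I(H) - 1, without subtraction; the depth of
   the standard graded algebra R_H / I(H) is taken at its irrelevant ideal. *)
Definition almost_CM : bool :=
  enat_le (krull_dim edge_ring) (omap succn (depth irrelevant_ideal)).

End EdgeIdeal.

(* Main.v *)
Require Import Defs.
From HB Require Import structures.
From mathcomp Require Import all_boot all_order all_algebra.
From mathcomp Require Import generic_quotient ring_quotient.
From mathcomp Require Import boolp classical_sets mpoly ring.

Set Implicit Arguments.
Unset Strict Implicit.
Unset Printing Implicit Defensive.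

Import GRing.Theory.

Local Open Scope ring_scope.
Local Open Scope classical_set_scope.
Local Open Scope quotient_scope.

(** Write A = R_G / I(G), let H be the graph G without v, and B = R_H / I(H).
    As v is the only neighbour of u, multiplication by u on A kills exactly the
    ideal generated by v, and A / (v) = B: the ring B is A / ann(u), so as an
    A-module it is the ideal uA.  Two inequalities then give the result.

    - dim B <= dim A, since A maps onto B ([krull_dim_surj]).
    - depth A <= depth B ([depth_transfer]).  This is the inequality
      depth S/I <= depth S/(I : u), valid for monomial ideals.

    The second inequality goes through Koszul cohomology H^j(xs; -) with respect
    to the vertices.  A regular sequence of length n in the irrelevant ideal
    makes H^j(xs; A) vanish for j < n ([regular_vanishing]).  This vanishing
    passes from A to B ([vanishing_transfer]).  Conversely, suppose that
    H^j(xs; B) = 0 for j < n.  A regular sequence b of length r < n satisfies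
    H^0(xs; B/(b)) = 0, so no nonzero element of B/(b) is killed by the
    irrelevant ideal, and as B is Noetherian, prime avoidance extends b to
    length r + 1 ([exists_regular], [vanishing_regular]).

    The transfer rests on an additive map eps : A -> B which takes the part of
    an element divisible by u and divides it by u.  It commutes with every vertex
    other than u and satisfies eps (u a) = phi a, where phi : A -> B is the
    projection.  It plays the role of a retraction, linear over the other
    variables, of the inclusion of uA in A.  The Koszul complex of the full list
    of vertices is the mapping cone of u on the complex of the other vertices, and
    cocycles over B are shown to be coboundaries by multiplying lifts by u, solving
    over A and applying eps. *)

(** * Ideals as sets *)

Section Ideals.
Variable A : comNzRingType.
Implicit Types (J X : set A) (a b f x y z : A) (s : seq A).

(** Unlike [idealr_closed], this allows the unit ideal, which occurs among the
    colon ideals and the ideals J + (f) below. *)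
Definition is_ideal J : Prop :=
  [/\ J 0, forall a b, J a -> J b -> J (a + b) & forall r a, J a -> J (r * a)].

Lemma ideal0 J : is_ideal J -> J 0. Proof. by case. Qed.
Lemma idealD J a b : is_ideal J -> J a -> J b -> J (a + b).
Proof. by case=> _ + _; apply. Qed.
Lemma idealM J r a : is_ideal J -> J a -> J (r * a).
Proof. by case=> _ _; apply. Qed.
Lemma idealN J a : is_ideal J -> J a -> J (- a).
Proof. by move=> iJ Ja; rewrite -mulN1r; apply: idealM. Qed.
Lemma idealB J a b : is_ideal J -> J a -> J b -> J (a - b).
Proof. by move=> iJ Ja Jb; apply: idealD => //; apply: idealN. Qed.

Lemma gen_ideal_is_ideal X : is_ideal (gen_ideal X).
Proof.
split.
- by exists [::]; rewrite big_nil.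
- move=> a b [s [sX ->]] [t [tX ->]]; exists (s ++ t); rewrite big_cat; split=> //.
  by move=> ag; rewrite mem_cat => /orP[/sX|/tX].
- move=> r a [s [sX ->]]; exists [seq (r * ag.1, ag.2) | ag <- s]; split.
    by move=> ag /mapP[bg /sX ? ->].
  by rewrite big_map mulr_sumr; apply: eq_bigr => ag _; rewrite mulrA.
Qed.

Lemma sub_gen_ideal X : X `<=` gen_ideal X.
Proof.
move=> x Xx; exists [:: (1, x)]; rewrite big_seq1 mul1r; split=> //.
by move=> ag; rewrite inE => /eqP->.
Qed.

Lemma gen_ideal_min X J : is_ideal J -> X `<=` J -> gen_ideal X `<=` J.
Proof.
move=> iJ XJ _ [s [sX ->]]; rewrite big_seq; elim/big_rec: _ => [|ag y ags Jy].
  exact: ideal0.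
by apply: idealD => //; apply: idealM => //; apply: XJ; apply: sX.
Qed.

Definition add_gen J f : set A := [set y | exists r, J (y - r * f)].

Lemma add_gen_is_ideal J f : is_ideal J -> is_ideal (add_gen J f).
Proof.
move=> iJ; split.
- by exists 0; rewrite mul0r subr0; apply: ideal0.
- move=> a b [r Ja] [t Jb]; exists (r + t).
  rewrite (_ : _ - _ = (a - r * f) + (b - t * f)); last by ring.
  exact: idealD.
- move=> c a [r Ja]; exists (c * r).
  rewrite (_ : _ - _ = c * (a - r * f)); last by ring.
  exact: idealM.
Qed.

Lemma sub_add_gen J f : is_ideal J -> J `<=` add_gen J f.
Proof. by move=> iJ a Ja; exists 0; rewrite mul0r subr0. Qed.

Lemma mem_add_gen J f : is_ideal J -> add_gen J f f.
Proof. by move=> iJ; exists 1; rewrite mul1r subrr; apply: ideal0. Qed.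

Lemma gen_ideal_nil : gen_ideal [set` [::]] = [set 0 : A].
Proof.
apply/seteqP; split=> [|y ->]; last by case: (gen_ideal_is_ideal [set` [::]]).
apply: gen_ideal_min => //; split=> [//|a b -> ->|r a ->]; by rewrite ?addr0 ?mulr0.
Qed.

Lemma gen_ideal_rcons s f :
  gen_ideal [set` rcons s f] = add_gen (gen_ideal [set` s]) f.
Proof.
have iS := gen_ideal_is_ideal [set` s].
apply/seteqP; split.
  apply: gen_ideal_min; first exact: add_gen_is_ideal.
  move=> x /=; rewrite mem_rcons inE => /predU1P[->|xs].
    exact: mem_add_gen.
  by apply: sub_add_gen => //; apply: sub_gen_ideal.
move=> y [r Jy]; rewrite -(subrK (r * f) y).
have iR := gen_ideal_is_ideal [set` rcons s f].
apply: idealD => //; last first.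
  by apply: idealM => //; apply: sub_gen_ideal; rewrite /= mem_rcons mem_head.
apply: gen_ideal_min Jy => // x xs; apply: sub_gen_ideal.
by rewrite /= mem_rcons inE xs orbT.
Qed.

Definition colon J z : set A := [set a | J (a * z)].

Lemma colon_is_ideal J z : is_ideal J -> is_ideal (colon J z).
Proof.
move=> iJ; split; rewrite /colon /=.
- by rewrite mul0r; apply: ideal0.
- by move=> a b Ja Jb; rewrite mulrDl; apply: idealD.
- by move=> r a Ja; rewrite -mulrA; apply: idealM.
Qed.

Definition regular_mod J f : Prop := forall a, J (f * a) -> J a.

End Ideals.

(** * Noetherian rings and the Hilbert basis theorem *)

Section Noetherian.

(** Classically equivalent to the ascending chain condition; this form applies directly
    to the leading coefficients in Hilbert's argument and to a strictly increasing
    chain of ideals, without forming unions of chains. *)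
Definition noetherian (A : comNzRingType) : Prop :=
  forall a : nat -> A, exists n, gen_ideal [set` mkseq a n] (a n).

Lemma noetherian_field (k : fieldType) : noetherian k.
Proof.
move=> a; have [a0|a0] := eqVneq (a 0%N) 0.
  by exists 0%N; rewrite a0; apply: ideal0; apply: gen_ideal_is_ideal.
exists 1%N; rewrite -(divfK a0 (a 1%N)); apply: idealM.
  exact: gen_ideal_is_ideal.
by apply: sub_gen_ideal; rewrite /= inE.
Qed.

Lemma noetherian_image (A B : comNzRingType) (f : {rmorphism A -> B}) :
  (forall b, exists a, f a = b) -> noetherian A -> noetherian B.
Proof.
move=> /choice[g gK] nA b; have [n bn] := nA (g \o b); exists n.
have iB := gen_ideal_is_ideal [set` mkseq b n].
rewrite -(gK (b n)).
have /gen_ideal_min : is_ideal [set a | gen_ideal [set` mkseq b n] (f a)].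
  split=> /= [|x y|r x]; rewrite ?(raddf0,rmorphD,rmorphM).
  - exact: ideal0.
  - exact: idealD.
  - exact: idealM.
apply; last exact: bn.
move=> x /= /mapP[i ni ->] /=; rewrite gK.
by apply: sub_gen_ideal; apply/mapP; exists i.
Qed.

Lemma poly_lead_drop (R : nzRingType) (f h : {poly R}) :
  (0 < size f)%N -> (size h <= size f)%N -> h`_(size f).-1 = lead_coef f ->
  (size (f - h)%R < size f)%N.
Proof.
move=> f0 hf hl; rewrite -(prednK f0) ltnS; apply/leq_sizeP => j.
rewrite leq_eqVlt => /predU1P[<-|fj]; first by rewrite coefB hl subrr.
rewrite coefB !nth_default ?subrr //; last by rewrite -(prednK f0).
by rewrite (leq_trans hf) // -(prednK f0).
Qed.

(** Hilbert's argument.  If f is a sequence of polynomials none of which lies in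
    the ideal of its past, the union I of these ideals is not finitely generated;
    choose g n of least size in I outside (g 0, ..., g (n-1)).  When the leading
    coefficient of g n is a combination of the earlier ones, subtracting the
    corresponding combination of shifts of the earlier g i lowers the size,
    against minimality. *)
Theorem noetherian_poly (R : comNzRingType) : noetherian R -> noetherian {poly R}.
Proof.
move=> nR f; apply: contrapT => /forallNP fN.
pose I := [set p | exists n, gen_ideal [set` mkseq f n] p].
have monI m n : (m <= n)%N ->
    gen_ideal [set` mkseq f m] `<=` gen_ideal [set` mkseq f n].
  move=> mn; apply: gen_ideal_min; first exact: gen_ideal_is_ideal.
  move=> x /= /mapP[i im ->]; apply: sub_gen_ideal; apply/mapP; exists i => //.
  by move: im; rewrite !mem_iota !add0n; move/leq_trans; apply.
have iI : is_ideal I.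
  split.
  - by exists 0%N; apply: ideal0; apply: gen_ideal_is_ideal.
  - move=> a b [m am] [n bn]; exists (maxn m n); apply: idealD.
    + exact: gen_ideal_is_ideal.
    + exact: monI (leq_maxl _ _) _ am.
    + exact: monI (leq_maxr _ _) _ bn.
  - by move=> r a [n an]; exists n; exact: idealM (gen_ideal_is_ideal _) an.
have fI n : I (f n).
  by exists n.+1; apply: sub_gen_ideal; apply/mapP; exists n; rewrite ?mem_iota ?add0n /=.
have nfg (s : seq {poly R}) : {subset s <= [pred x | `[< I x >]]} ->
    exists p, I p /\ ~ gen_ideal [set` s] p.
  move=> sI; have [n sn] : exists n, [set` s] `<=` gen_ideal [set` mkseq f n].
    elim: s sI => [|x s IH] sI; first by exists 0%N.
    have [|n sn] := IH; first by move=> y ys; apply: sI; rewrite inE ys orbT.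
    have /asboolP[m xm] := sI x (mem_head _ _).
    exists (maxn m n) => y /=; rewrite inE => /predU1P[->|ys].
      exact: monI (leq_maxl _ _) _ xm.
    exact: monI (leq_maxr _ _) _ (sn y ys).
  exists (f n); split=> // fs; apply: (fN n).
  by apply: gen_ideal_min fs => //; apply: gen_ideal_is_ideal.
have minI (s : seq {poly R}) : exists p, {subset s <= [pred x | `[< I x >]]} ->
    [/\ I p, ~ gen_ideal [set` s] p &
     forall q, I q -> ~ gen_ideal [set` s] q -> (size p <= size q)%N].
  have [sI|?] := pselect ({subset s <= [pred x | `[< I x >]]}); last by exists 0.
  have [p0 [Ip0 np0]] := nfg s sI.
  have ex : exists n, `[< exists p, [/\ I p, ~ gen_ideal [set` s] p & size p = n] >].
    by exists (size p0); apply/asboolP; exists p0.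
  have [n /asboolP[p [Ip np sp]] nmin] := ex_minnP ex.
  exists p => _; split=> // q Iq nq; rewrite sp; apply: nmin; apply/asboolP.
  by exists q.
have [F FP] := choice minI.
(* L n lists g 0, ..., g (n-1); g is defined from its own past. *)
pose L := fix L n := if n is m.+1 then rcons (L m) (F (L m)) else [::].
pose g n := F (L n).
have Lg n : L n = mkseq g n.
  elim: n => //= n IH; rewrite /mkseq -[n.+1]addn1 iotaD map_cat /= cats1.
  by rewrite add0n -[map g _]/(mkseq g n) -IH.
have LI n : {subset L n <= [pred x | `[< I x >]]}.
  elim: n => //= n IH x; rewrite mem_rcons inE => /predU1P[->|/IH //].
  by apply/asboolP; case: (FP _ IH).
have [n gn] := nR (fun n => lead_coef (g n)).
have [Ign ngn gmin] := FP _ (LI n); rewrite -/(g n) in Ign ngn gmin.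
have iL := gen_ideal_is_ideal [set` L n].
have gn0 : (0 < size (g n))%N.
  rewrite size_poly_gt0; apply/eqP => g0; apply: ngn; rewrite g0; exact: ideal0.
(* The elements of (g 0, ..., g (n-1)) of size at most that of g n, seen through
   their coefficient in the degree of g n. *)
pose C := [set c | exists h, [/\ gen_ideal [set` L n] h,
  (size h <= size (g n))%N & h`_(size (g n)).-1 = c]].
have iC : is_ideal C.
  split.
  - by exists 0; rewrite size_poly0 coef0; split=> //; apply: ideal0.
  - move=> a b [p [Lp sp <-]] [q [Lq sq <-]]; exists (p + q); rewrite coefD.
    split=> //; first exact: idealD.
    by rewrite (leq_trans (size_polyD _ _)) // geq_max sp.
  - move=> r a [p [Lp sp <-]]; exists (r%:P * p); rewrite coefCM; split=> //.
      exact: idealM.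
    by rewrite mul_polyC (leq_trans (size_scale_leq _ _)).
have [h [Lh sh hl]] : C (lead_coef (g n)).
  apply: gen_ideal_min gn => // c /= /mapP[i]; rewrite mem_iota add0n => ilt ->.
  have Lgi : gen_ideal [set` L n] (g i).
    by apply: sub_gen_ideal; rewrite /= Lg; apply/mapP; exists i; rewrite ?mem_iota.
  (* g n was still a candidate when g i was chosen. *)
  have sgi : (size (g i) <= size (g n))%N.
    have [_ _] := FP _ (LI i); apply=> // gi; apply: ngn.
    apply: gen_ideal_min gi => // x /=; rewrite !Lg => /mapP[j ji ->].
    apply: sub_gen_ideal; apply/mapP; exists j => //.
    by move: ji; rewrite !mem_iota !add0n => /ltn_trans; apply.
  exists ('X^(size (g n) - size (g i)) * g i); split.
  - exact: idealM.
  - rewrite (leq_trans (size_polyMleq _ _)) // size_polyXn /=.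
    by rewrite subnK.
  - have [gi0|gi0] := posnP (size (g i)).
      move/eqP: gi0; rewrite size_poly_eq0 => /eqP ->.
      by rewrite mulr0 coef0 lead_coef0.
    have -> : (size (g n)).-1 = (size (g n) - size (g i) + (size (g i)).-1)%N.
      by rewrite -subn1 -[(size (g i)).-1]subn1 addnBA // subnK.
    by rewrite coefXnM ltnNge leq_addr /= addKn.
have := poly_lead_drop gn0 sh hl; rewrite ltnNge; case/negP; apply: gmin.
  by apply: idealB => //; apply: (gen_ideal_min iI _ Lh) => x /LI /asboolP.
by move=> Lgh; apply: ngn; rewrite -(subrK h (g n)); apply: idealD.
Qed.

Lemma mpoly_ind_gen (n : nat) (R : nzRingType) (Q : {mpoly R[n]} -> Prop) :
  (forall c, Q c%:MP) -> (forall i, Q 'X_i) ->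
  (forall p q, Q p -> Q q -> Q (p + q)) -> (forall p q, Q p -> Q q -> Q (p * q)) ->
  forall p, Q p.
Proof.
move=> QC QX QD QM; elim/mpolyind => [|c m p _ _ Qp]; first exact: QC 0.
apply: QD => //; rewrite -mul_mpolyC; apply: (QM) => //.
rewrite mpolyXE_id; apply: big_ind => [||i _]; [exact: (QC 1) | exact: (QM) |].
elim: (m i) => [|j IH]; first by rewrite expr0; exact: (QC 1).
by rewrite exprS; apply: QM.
Qed.

Theorem noetherian_mpoly (k : fieldType) n : noetherian {mpoly k[n]}.
Proof.
elim: n => [|n IH].
  apply: (@noetherian_image _ _ (mpolyC 0 (R := k))); last exact: noetherian_field.
  apply: mpoly_ind_gen => [c|[]//|p q [a <-] [b <-]|p q [a <-] [b <-]].
  - by exists c.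
  - by exists (a + b); rewrite rmorphD.
  - by exists (a * b); rewrite rmorphM.
pose f : {rmorphism {poly {mpoly k[n]}} -> {mpoly k[n.+1]}} :=
  horner_eval 'X_(ord_max) \o map_poly (@mwiden n k).
apply: (@noetherian_image _ _ f); last exact: noetherian_poly.
apply: mpoly_ind_gen => [c|i|p q [a <-] [b <-]|p q [a <-] [b <-]].
- by exists (c%:MP)%:P; rewrite /f /= /horner_eval map_polyC hornerC /= mwidenC.
- rewrite /f /= /horner_eval; case: (unliftP ord_max i) => [j|] ->.
    exists ('X_j)%:P; rewrite map_polyC hornerC /= mwidenX mnmwiden1.
    by congr 'X_[_]; congr mnm1; apply: val_inj; rewrite /= /bump leqNgt ltn_ord.
  by exists 'X; rewrite map_polyX hornerX.
- by exists (a + b); rewrite rmorphD.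
- by exists (a * b); rewrite rmorphM.
Qed.

End Noetherian.

(** * Associated primes and prime avoidance *)

Section AssociatedPrimes.
Variable A : comNzRingType.
Hypothesis nA : noetherian A.
Implicit Types (J p q m : set A) (a b x y z w : A).

Lemma noetherian_max (T : Type) (f : T -> set A) (P : T -> Prop) :
  (forall t, P t -> is_ideal (f t)) -> (exists t, P t) ->
  exists t, P t /\ forall t', P t' -> f t `<=` f t' -> f t' `<=` f t.
Proof.
move=> fP [t0 Pt0]; apply: contrapT => nomax.
have step t : exists t', P t -> [/\ P t', f t `<=` f t' & exists a, f t' a /\ ~ f t a].
  have [Pt|?] := pselect (P t); last by exists t.
  apply: contrapT => /forallNP tmax; apply: nomax; exists t; split=> // t' Pt' tt' a t'a.
  apply: contrapT => nta; apply: (tmax t') => _; split=> //; by exists a.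
have [g gP] := choice step.
pose F n := iter n g t0.
have PF n : P (F n) by elim: n => //= n /gP[].
have FS n : f (F n) `<=` f (F n.+1) by have [] := gP _ (PF n).
have Fle i n : (i <= n)%N -> f (F i) `<=` f (F n).
  move=> /subnK <-; elim: (n - i)%N => // d IH; exact: subset_trans IH (FS _).
have [a aP] := choice (fun n => let: And3 _ _ h := gP _ (PF n) in h).
have [n an] := nA a; have [_ []] := aP n.
apply: gen_ideal_min an; first exact: fP.
move=> x /= /mapP[i]; rewrite mem_iota add0n => /andP[_ ilt] ->.
by apply: (Fle i.+1 n ilt); case: (aP i).
Qed.

Definition is_prime p : Prop :=
  [/\ is_ideal p, ~ p 1 & forall x y, p (x * y) -> p x \/ p y].

Lemma max_colon_prime J w : is_ideal J -> ~ J w ->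
  (forall w', ~ J w' -> colon J w `<=` colon J w' -> colon J w' `<=` colon J w) ->
  is_prime (colon J w).
Proof.
move=> iJ nw wmax; split; first exact: colon_is_ideal.
  by rewrite /colon /= mul1r.
move=> x y xyw; have [yw|nyw] := pselect (J (y * w)); [by right | left].
apply: (wmax (y * w)) => //; last by rewrite /colon /= mulrA.
by move=> a aw; rewrite /colon /= mulrCA; apply: idealM.
Qed.

Lemma zero_divisor_prime J a z : is_ideal J -> ~ J z -> J (a * z) ->
  exists w, [/\ ~ J w, J (a * w) & is_prime (colon J w)].
Proof.
move=> iJ nz az.
have [||w [[nw aw] wmax]] :=
    @noetherian_max A (colon J) (fun w => ~ J w /\ J (a * w)).
- by move=> w _; apply: colon_is_ideal.
- by exists z.
exists w; split=> //; apply: max_colon_prime => // w' nw' ww'.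
by apply: (wmax w') => //; split=> //; apply: (ww' a).
Qed.

(** Noetherian induction: for J maximal among the ideals with infinitely many
    associated primes, take an associated prime (J : w).  An associated prime
    (J : z) either equals (J : w), when some multiple of z outside J lies in
    J + (w), or it is associated to the larger ideal J + (w). *)
Lemma finite_associated_primes J : is_ideal J ->
  exists L : seq (set A), forall w, is_prime (colon J w) -> colon J w \in L.
Proof.
pose bad J := is_ideal J /\ ~ exists L : seq (set A),
  forall w, is_prime (colon J w) -> colon J w \in L.
move=> iJ; apply: contrapT => badJ.
have [||{}J [[{badJ}iJ badJ] Jmax]] := @noetherian_max (set A) id bad.
- by move=> ? [].
- by exists J.
apply: badJ; have [J1|nJ1] := pselect (J 1).
  by exists [::] => w [_ []]; rewrite /colon /= mul1r -[w]mulr1; apply: idealM.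
have [|w [nw _ pw]] := zero_divisor_prime iJ nJ1 (a := 0).
  by rewrite mul0r; apply: ideal0.
have iJw := add_gen_is_ideal w iJ.
have [L LP] : exists L : seq (set A),
    forall z, is_prime (colon (add_gen J w) z) -> colon (add_gen J w) z \in L.
  apply: contrapT => bJw; apply: nw; apply: (Jmax (add_gen J w)) => //.
    exact: sub_add_gen.
  exact: mem_add_gen.
exists (colon J w :: L) => z pz; rewrite inE; apply/orP.
have [iz z1 zM] := pz.
have [[r [nr rz]]|nor] := pselect (exists r, ~ J (r * z) /\ add_gen J w (r * z)).
  left; apply/eqP; have [c cw] := rz.
  (* r z and c w agree modulo J, so they have the same annihilator modulo J. *)
  have cwJ b : J (b * (r * z)) <-> J (b * (c * w)).
    rewrite -[b * (r * z)](subrK (b * (c * w))) -mulrBr.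
    split=> h; last by apply: idealD => //; apply: idealM.
    rewrite -(addKr (b * (r * z - c * w)) (b * (c * w))).
    by apply: idealD => //; apply: idealN => //; apply: idealM.
  have [_ _ wM] := pw.
  have nc : ~ J (c * w).
    by move=> /(idealD iJ cw); rewrite subrK.
  apply/seteqP; split=> b; rewrite /colon /= => bJ.
    have /cwJ : J (b * (r * z)) by rewrite mulrCA; apply: idealM.
    by rewrite mulrA => /wM[|/nc].
  have /cwJ : J (b * (c * w)) by rewrite mulrCA; apply: idealM.
  by rewrite mulrA => /zM[|/nr].
have zE : colon J z = colon (add_gen J w) z.
  apply/seteqP; split=> r rz; first exact: (sub_add_gen w iJ rz).
  by apply: contrapT => nr; apply: nor; exists r.
by right; rewrite zE; apply: LP; rewrite -zE.
Qed.

(** Induction on the number of primes.  If some member of L is contained in p, it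
    can be dropped, since avoiding p avoids it.  Otherwise let a avoid L; if a
    lies in p, add to it an element of m that lies in every prime of L but not
    in p. *)
Lemma prime_avoidance m (L : seq (set A)) : is_ideal m ->
  exists a, m a /\ forall p, p \in L -> is_prime p -> ~ m `<=` p -> ~ p a.
Proof.
move=> im; have [n] := ubnP (size L); elim: n L => // n IH [|p L] /= sL.
  by exists 0; split=> //; apply: ideal0.
have [a [ma aL]] := IH L sL.
have [[pp /existsNP[x /not_implyP[mx npx]]]|np] :=
    pselect (is_prime p /\ ~ m `<=` p); last first.
  exists a; split=> // q; rewrite inE => /predU1P[->|/aL//] pq mq.
  by case: np.
have [[q [qL qp]]|nsub] := pselect (exists q, q \in L /\ q `<=` p).
  have [|b [mb bL]] := IH (p :: rem q L).
    by rewrite /= size_rem // prednK //; case: (L) qL.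
  exists b; split=> // r; rewrite inE => /predU1P[->|rL].
    by apply: bL; rewrite mem_head.
  have := rL; rewrite (perm_mem (perm_to_rem qL)) inE => /predU1P[->|rq].
    move=> _ _ /qp; apply: bL => //; first by rewrite mem_head.
    by apply/existsNP; exists x; apply/not_implyP.
  by apply: bL; rewrite inE rq orbT.
have [pa|npa] := pselect (p a); last first.
  by exists a; split=> // q; rewrite inE => /predU1P[->|/aL].
have [ip p1 pM] := pp.
have [b [mb npb bL]] : exists b, [/\ m b, ~ p b & forall q, q \in L -> is_prime q -> q b].
  elim: L nsub {IH sL aL} => [|q L IH] nsub; first by exists x.
  have [|b [mb npb bL]] := IH.
    by move=> [r [rL rp]]; apply: nsub; exists r; rewrite inE rL orbT.
  have [c [qc npc]] : exists c, q c /\ ~ p c.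
    apply: contrapT => nc; apply: nsub; exists q; rewrite mem_head; split=> // c qc.
    by apply: contrapT => npc; apply: nc; exists c.
  exists (c * b); split; [exact: idealM | by move=> /pM[] |].
  move=> r; rewrite inE => /predU1P[->|/bL rb] pr.
    by rewrite mulrC; apply: idealM => //; case: pr.
  by apply: idealM; [case: pr | apply: rb].
exists (a + b); split; first exact: idealD.
move=> q; rewrite inE => /predU1P[->|qL] pq mq qab.
  by apply: npb; rewrite -[b](addKr a) addrC; apply: idealB.
by apply: (aL q qL pq mq); rewrite -[a](addrK b); apply: idealB; [case: pq| |apply: bL].
Qed.

(** The zero divisors modulo J lie in finitely many primes of the form (J : w);
    if no such prime contains m, then m is not contained in their union. *)
Theorem exists_regular J m : is_ideal J -> is_ideal m ->
  (forall z, (forall a, m a -> J (a * z)) -> J z) ->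
  exists a, m a /\ regular_mod J a.
Proof.
move=> iJ im nosocle; have [L LP] := finite_associated_primes iJ.
have [a [ma aL]] := prime_avoidance L im.
exists a; split=> // z az; apply: contrapT => nz.
have [w [nw aw pw]] := zero_divisor_prime iJ nz az.
by apply: (aL (colon J w)) => //; [exact: LP | move=> mw; apply/nw/nosocle].
Qed.

End AssociatedPrimes.

(** * Koszul cohomology *)

Section Koszul.
Variable A : comNzRingType.
Implicit Types (J : set A) (a b f x y z : A) (xs gs : seq A) (s : seq bool).
Implicit Types (c e : seq bool -> A).

(** A cochain assigns a ring element to each subset of the indices of xs, a subset
    being given by its characteristic sequence; its degree j part is its restriction
    to the subsets with j elements.  The complex of x :: xs is the mapping
    cone of x on the complex of xs, with (a, b) sent to (d a, x a - d b), where a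
    is the restriction to the subsets without the first index and b the restriction
    to the others. *)
Fixpoint koszul_d xs c s : A :=
  match xs, s with
  | x :: xs', b :: s' =>
    if b then x * c (false :: s') - koszul_d xs' (fun t => c (true :: t)) s'
    else koszul_d xs' (fun t => c (false :: t)) s'
  | _, _ => 0
  end.

(** Contraction with the coefficients gs, a homotopy between 0 and multiplication
    by the combination of xs with these coefficients. *)
Fixpoint koszul_h gs c s : A :=
  match gs, s with
  | g :: gs', b :: s' =>
    if b then - koszul_h gs' (fun t => c (true :: t)) s'
    else g * c (true :: s') + koszul_h gs' (fun t => c (false :: t)) s'
  | _, _ => 0
  end.

Lemma koszul_d_lin xs r c e s :
  koszul_d xs (fun t => r * c t + e t) s = r * koszul_d xs c s + koszul_d xs e s.
Proof.
elim: xs c e s => [|x xs IH] c e [|[] s] /=; rewrite ?mulr0 ?addr0 //.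
by rewrite IH; ring.
Qed.

Lemma koszul_d0 xs s : koszul_d xs (fun=> 0) s = 0.
Proof.
by elim: xs s => [|x xs IH] [|[] s] //=; rewrite IH ?mulr0 ?subr0.
Qed.

Lemma koszul_dZ xs r c s : koszul_d xs (fun t => r * c t) s = r * koszul_d xs c s.
Proof.
have := koszul_d_lin xs r c (fun=> 0) s; rewrite koszul_d0 addr0 => <-.
by congr koszul_d; apply: funext => t; rewrite addr0.
Qed.

Lemma koszul_dD xs c e s :
  koszul_d xs (fun t => c t + e t) s = koszul_d xs c s + koszul_d xs e s.
Proof.
have := koszul_d_lin xs 1 c e s; rewrite mul1r => <-.
by congr koszul_d; apply: funext => t; rewrite mul1r.
Qed.

Lemma koszul_dB xs c e s :
  koszul_d xs (fun t => c t - e t) s = koszul_d xs c s - koszul_d xs e s.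
Proof.
rewrite addrC -mulN1r -koszul_d_lin; congr koszul_d.
by apply: funext => t; rewrite mulN1r addrC.
Qed.

Lemma koszul_dd xs c s : koszul_d xs (koszul_d xs c) s = 0.
Proof.
elim: xs c s => [|x xs IH] c [|[] s] //=.
by rewrite koszul_dB koszul_dZ IH subr0 subrr.
Qed.

Lemma koszul_dN xs c s : koszul_d xs (fun t => - c t) s = - koszul_d xs c s.
Proof.
by rewrite -mulN1r -koszul_dZ; congr koszul_d; apply: funext => t; rewrite mulN1r.
Qed.

Lemma koszul_h_lin gs r c e s :
  koszul_h gs (fun t => r * c t - e t) s = r * koszul_h gs c s - koszul_h gs e s.
Proof.
elim: gs c e s => [|g gs IH] c e [|[] s] /=; rewrite ?mulr0 ?subr0 //.
all: by rewrite IH; ring.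
Qed.

Lemma koszul_homotopy gs xs c s : size gs = size xs -> size s = size xs ->
  koszul_d xs (koszul_h gs c) s + koszul_h gs (koszul_d xs c) s =
  (\sum_(gx <- zip gs xs) gx.1 * gx.2) * c s.
Proof.
elim: xs gs c s => [|x xs IH] [|g gs] c [|b s] //=.
  by rewrite big_nil mul0r addr0.
move=> [sg] [ss]; rewrite big_cons /= mulrDl; case: b => /=.
  by rewrite koszul_dN koszul_h_lin -(IH gs (fun t => c (true :: t)) s sg ss); ring.
by rewrite koszul_d_lin -(IH gs (fun t => c (false :: t)) s sg ss); ring.
Qed.

Lemma koszul_d_count0 xs c s : count id s = 0%N -> koszul_d xs c s = 0.
Proof. by elim: xs c s => [|x xs IH] c [|[] s] //=; rewrite add0n => /IH. Qed.

(** Only the values in degree j are constrained, so that homogeneous cochains need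
    no separate type. *)
Definition null J xs j c : Prop :=
  forall s, size s = size xs -> count id s = j -> J (c s).

Lemma d_null J xs j c : is_ideal J ->
  null J xs j c -> null J xs j.+1 (koszul_d xs c).
Proof.
move=> iJ; elim: xs c j => [|x xs IH] c j cJ [|[] s] //= [ss].
  move=> [sj]; apply: idealB => //; first by apply: idealM => //; apply: cJ => /=; rewrite ?ss.
  case: j => [|j] in cJ sj *; last first.
    by apply: (IH (fun t => c (true :: t)) j) => // t tt tj; apply: cJ; rewrite /= ?tt ?tj.
  by rewrite koszul_d_count0 //; apply: ideal0.
rewrite add0n => sj.
by apply: (IH (fun t => c (false :: t)) j) => // t tt tj; apply: cJ; rewrite /= ?tt ?tj.
Qed.

Lemma h_null J gs xs j c : is_ideal J -> size gs = size xs ->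
  null J xs j.+1 c -> null J xs j (koszul_h gs c).
Proof.
move=> iJ; elim: xs gs c j => [|x xs IH] [|g gs] c j //=.
  by move=> _ _ ? _ _; apply: ideal0.
move=> [sg] cJ [|[] s] //= [ss].
  case: j => [|j] in cJ * => // -[sj]; apply: idealN => //.
  by apply: (IH gs (fun t => c (true :: t)) j) => // t tt tj; apply: cJ; rewrite /= ?tt ?tj.
rewrite add0n => sj; apply: idealD => //.
  by apply: idealM => //; apply: cJ; rewrite /= ?ss ?sj.
by apply: (IH gs (fun t => c (false :: t)) j) => // t tt tj; apply: cJ; rewrite /= ?tt ?tj.
Qed.

(** H^j(xs; A/J) = 0 for all j < n.  In degree 0 the coboundary contributes
    nothing, since it vanishes on the empty subset. *)
Definition vanishing J xs n : Prop :=
  forall j c, (j < n)%N -> null J xs j.+1 (koszul_d xs c) ->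
  exists e, null J xs j (fun s => c s - koszul_d xs e s).

(** From the long exact sequence of 0 -> A/J -> A/J -> A/(J + (f)) -> 0, the first
    map being multiplication by f: as f lies in the ideal of xs, it acts as zero on
    cohomology, so the connecting map from H^(j-1)(A/(J + (f))) to H^j(A/J) is onto.
    Concretely, f c = d (h c) for a cocycle c, so h c is a cocycle modulo J + (f). *)
Lemma vanishing_add_gen J xs gs n f : is_ideal J -> size gs = size xs ->
  f = \sum_(gx <- zip gs xs) gx.1 * gx.2 -> regular_mod J f ->
  vanishing (add_gen J f) xs n -> vanishing J xs n.+1.
Proof.
move=> iJ sg fE regf van j c jn dc.
have fc s : size s = size xs -> count id s = j ->
    J (koszul_d xs (koszul_h gs c) s - f * c s).
  move=> ss sj; rewrite fE -(koszul_homotopy _ sg ss) opprD addrA subrr sub0r.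
  by apply: idealN => //; apply: (h_null iJ sg dc).
case: j => [|j] in c jn dc fc *.
  exists (fun=> 0) => s ss sj; rewrite koszul_d0 subr0; apply: regf.
  have := fc s ss sj; rewrite koszul_d_count0 // sub0r => /(idealN iJ).
  by rewrite opprK.
have [//||e eP] := van j (koszul_h gs c).
  by move=> s ss sj; exists (c s); rewrite mulrC; apply: fc.
have [e1 e1P] : exists e1, null J xs j (fun s => koszul_h gs c s - koszul_d xs e s - f * e1 s).
  have /choice[e1 e1P] : forall s, exists r, size s = size xs -> count id s = j ->
      J (koszul_h gs c s - koszul_d xs e s - f * r).
    move=> s; have [ss|?] := pselect (size s = size xs); last by exists 0.
    have [sj|?] := pselect (count id s = j); last by exists 0.
    by have [r] := eP s ss sj; exists r; rewrite mulrC.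
  by exists e1.
exists e1 => s ss sj; apply: regf.
have := d_null iJ e1P ss sj; rewrite !koszul_dB koszul_dd koszul_dZ subr0 => deJ.
rewrite mulrBr; rewrite (_ : _ - _ = (koszul_d xs (koszul_h gs c) s - f * koszul_d xs e1 s)
  - (koszul_d xs (koszul_h gs c) s - f * c s)); last by ring.
by apply: idealB => //; apply: fc.
Qed.

(** The same sequence read the other way: H^j(A/(J + (f))) sits between H^j(A/J) and
    H^(j+1)(A/J). *)
Lemma vanishing_quotient J xs n f : is_ideal J -> regular_mod J f ->
  vanishing J xs n.+1 -> vanishing (add_gen J f) xs n.
Proof.
move=> iJ regf van j c jn dc.
have [c1 dcE] : exists c1, null J xs j.+1 (fun s => koszul_d xs c s - c1 s * f).
  have /choice[c1 c1P] : forall s, exists r, size s = size xs -> count id s = j.+1 ->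
      J (koszul_d xs c s - r * f).
    move=> s; have [ss|?] := pselect (size s = size xs); last by exists 0.
    have [sj|?] := pselect (count id s = j.+1); last by exists 0.
    by have [r] := dc s ss sj; exists r.
  by exists c1.
have [||e eP] := van j.+1 c1; first by rewrite ltnS.
  move=> s ss sj; apply: regf.
  have := d_null iJ dcE ss sj; rewrite koszul_dB koszul_dd sub0r.
  move=> /(idealN iJ); rewrite opprK -koszul_dZ.
  by congr (J (koszul_d _ _ _)); apply: funext => t; rewrite mulrC.
have [||e' e'P] := van j (fun s => c s - f * e s); first exact: ltnW.
  move=> s ss sj; rewrite koszul_dB koszul_dZ.
  rewrite (_ : _ - _ = (koszul_d xs c s - c1 s * f) + f * (c1 s - koszul_d xs e s));
    last by ring.
  by apply: idealD => //; [exact: dcE | apply: idealM => //; apply: eP].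
exists e' => s ss sj; exists (e s).
rewrite (_ : _ - _ - _ = c s - f * e s - koszul_d xs e' s); last by ring.
exact: e'P.
Qed.

End Koszul.

(** * Vanishing and regular sequences *)

Section RegularSequences.
Variable A : comNzRingType.
Implicit Types (J m : set A) (xs s gs : seq A).

Lemma gen_ideal_lincomb xs f : gen_ideal [set` xs] f ->
  exists2 gs, size gs = size xs & f = \sum_(gx <- zip gs xs) gx.1 * gx.2.
Proof.
elim: xs f => [|x xs IH] f.
  by rewrite gen_ideal_nil => ->; exists [::]; rewrite ?big_nil.
pose C := add_gen (gen_ideal [set` xs]) x.
have iX := gen_ideal_is_ideal [set` xs].
move=> fx; have [r /IH[gs sg E]] : C f.
  apply: gen_ideal_min fx; first exact: add_gen_is_ideal.
  move=> y /=; rewrite inE => /predU1P[->|yx]; first exact: mem_add_gen.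
  by apply: sub_add_gen => //; apply: sub_gen_ideal.
by exists (r :: gs); rewrite /= ?sg // big_cons -E addrC subrK.
Qed.

Lemma regular_vanishing xs s : {in s, forall a, gen_ideal [set` xs] a} ->
  regular_sequence s -> vanishing [set 0] xs (size s).
Proof.
move=> sx [reg _]; rewrite -gen_ideal_nil -(take0 s).
suff h i : (i <= size s)%N -> vanishing (gen_ideal [set` take (size s - i) s]) xs i.
  by have := h _ (leqnn _); rewrite subnn.
elim: i => [|i IH] ilt; first by move=> j c; rewrite ltn0.
have lt : (size s - i.+1 < size s)%N by rewrite ltn_subrL (leq_trans _ ilt).
have [gs sg E] := gen_ideal_lincomb (sx _ (mem_nth 0 lt)).
apply: (vanishing_add_gen _ sg E); first exact: gen_ideal_is_ideal.
  exact: reg.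
by rewrite -gen_ideal_rcons -take_nth // -subSn //= subSS; apply/IH/ltnW.
Qed.

(** The constant z is a cocycle of degree 0 modulo J. *)
Lemma vanishing_no_socle J xs n z : is_ideal J -> vanishing J xs n.+1 ->
  {in xs, forall x, J (x * z)} -> J z.
Proof.
move=> iJ van xz.
have [//||e eP] := van 0%N (fun=> z).
  elim: xs xz {van} => [|x xs IH] xz [|[] s] //= [ss].
    rewrite add1n => -[sj]; rewrite koszul_d_count0 // subr0.
    by apply: xz; rewrite mem_head.
  by move=> sj; apply: IH => // y ys; apply: xz; rewrite inE ys orbT.
have c0 r : count id (nseq r false) = 0%N by elim: r.
have := eP (nseq (size xs) false) (size_nseq _ _) (c0 _).
by rewrite koszul_d_count0 // subr0.
Qed.

Lemma vanishing_regular m xs n : noetherian A -> is_ideal m -> ~ m 1 ->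
  {in xs, forall x, m x} -> vanishing [set 0] xs n ->
  exists s, [/\ size s = n, {in s, forall a, m a} & regular_sequence s].
Proof.
move=> nA im m1 xm van.
suff h j : (j <= n)%N -> exists s, [/\ size s = j, {in s, forall a, m a},
    forall i, (i < size s)%N -> regular_mod (gen_ideal [set` take i s]) s`_i &
    vanishing (gen_ideal [set` s]) xs (n - j)].
  have [s [sn sm sr _]] := h n (leqnn n); exists s; split=> //; split=> //.
  by move=> s1; apply: m1; apply: gen_ideal_min s1.
elim: j => [|j IH] jn.
  by exists [::]; split; rewrite ?gen_ideal_nil ?subn0.
have [s [sj sm sr vs]] := IH (ltnW jn).
have iS := gen_ideal_is_ideal [set` s].
rewrite -(prednK (_ : 0 < n - j)%N) ?subn_gt0 // -subnS in vs.
have [z zm|f [mf rf]] := exists_regular nA iS im.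
  by apply: (vanishing_no_socle iS vs) => x /xm /zm.
exists (rcons s f); rewrite size_rcons sj; split=> //.
- by move=> a; rewrite mem_rcons inE => /predU1P[->|/sm].
- move=> i; rewrite ltnS leq_eqVlt => /predU1P[->|ij].
    by rewrite nth_rcons sj ltnn eqxx -cats1 -sj take_size_cat.
  rewrite nth_rcons sj ij -cats1 take_cat sj ij; apply: sr; by rewrite sj.
- by rewrite gen_ideal_rcons; apply: vanishing_quotient.
Qed.

End RegularSequences.

(** * Transfer along the projection onto A / ann(u) *)

Lemma koszul_d_map (A B : comNzRingType) (phi : A -> B) (g : {additive A -> B})
    (xs : seq A) (c : seq bool -> A) s :
  {in xs, forall x a, g (x * a) = phi x * g a} ->
  g (koszul_d xs c s) = koszul_d (map phi xs) (fun t => g (c t)) s.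
Proof.
elim: xs c s => [|x xs IH] c s gx /=; first by rewrite raddf0.
have gxs : {in xs, forall x a, g (x * a) = phi x * g a}.
  by move=> y ys; apply: gx; rewrite inE ys orbT.
case: s => [|[] s]; rewrite ?raddf0 ?raddfB ?IH // gx ?mem_head //.
Qed.

Section Transfer.
Variables (A B : comNzRingType) (phi : {rmorphism A -> B}) (eps : {additive A -> B}).
Variables (u : A) (xs : seq A).
Hypothesis phi_surj : forall b, exists a, phi a = b.
Hypothesis phi_ker : forall a, phi a = 0 -> u * a = 0.
Hypothesis eps_lin : {in xs, forall x a, eps (x * a) = phi x * eps a}.
Hypothesis eps_u : forall a, eps (u * a) = phi a.

(** Let (a, b) be a cocycle over B.  Then u (a, b), computed on lifts, is a cocycle
    over A, since u kills the kernel of phi; solving u a = d e0 and applying eps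
    gives a = d (eps e0).  Subtracting the coboundary of (eps e0, 0) leaves a cocycle
    (0, c).  Solving over A twice, first for (0, u c), whose solution f0 again gives a
    cocycle (0, f0), yields u c = u (u g0 - d g1) - d f1 with d g0 = 0, and applying
    eps turns this into c = u (phi g0) - d (phi g1 + eps f1), a coboundary.  Solving
    only once would leave the term eps (u f0) = phi f0, which need not be divisible
    by u modulo coboundaries. *)
Theorem vanishing_transfer n :
  vanishing [set 0] (u :: xs) n -> vanishing [set 0] (map phi (u :: xs)) n.
Proof.
move=> van j c jn dc.
have phi_lin ys : {in ys, forall x a, phi (x * a) = phi x * phi a}.
  by move=> x _ a; rewrite rmorphM.
have [l lK] := choice phi_surj.
have phi_d ys (e : seq bool -> A) s :
    phi (koszul_d ys e s) = koszul_d (map phi ys) (fun t => phi (e t)) s.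
  exact: koszul_d_map.
have eps_d (e : seq bool -> A) s :
    eps (koszul_d xs e s) = koszul_d (map phi xs) (fun t => eps (e t)) s.
  exact: koszul_d_map.
have lift (e : seq bool -> B) : (fun t => phi (l (e t))) = e.
  by apply: funext => t; rewrite lK.
have [//||e eP] := van j (fun s => u * l (c s)).
  move=> s ss sj; rewrite koszul_dZ; apply: phi_ker; rewrite phi_d lift.
  by apply: dc; rewrite ?size_map.
pose e0 t := e (false :: t).
have c0E s : size s = size xs -> count id s = j ->
    c (false :: s) = koszul_d (map phi xs) (fun t => eps (e0 t)) s.
  move=> ss sj; rewrite -eps_d -[LHS]lK -eps_u.
  congr (eps _); apply/eqP; rewrite -subr_eq0; apply/eqP.
  by apply: (eP (false :: s)); rewrite /= ?ss.
(* A lift of eps e0, used to subtract the coboundary of (eps e0, 0). *)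
pose ga t := l (eps (e0 t)).
(* Cocycles of the form (0, k) in the mapping cone. *)
have van_top (k : seq bool -> A) :
    (forall s, size s = size xs -> count id s = j -> koszul_d xs k s = 0) ->
    exists f0 f1 : seq bool -> A,
      (forall s, size s = size xs -> (count id s).+1 = j ->
         k s = u * f0 s - koszul_d xs f1 s) /\
      (forall s, size s = size xs -> count id s = j -> koszul_d xs f0 s = 0).
  move=> kd; pose D s := if s is true :: t then k t else 0.
  have [//||f fP] := van j D.
    move=> [|[] s] // [ss] sj; last exact: koszul_d0.
    have -> : koszul_d (u :: xs) D (true :: s) = u * 0 - koszul_d xs k s by [].
    by case: sj => sj; rewrite mulr0 kd ?subr0.
  exists (fun t => f (false :: t)), (fun t => f (true :: t)); split=> s ss sj.
    apply/eqP; rewrite -subr_eq0; apply/eqP.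
    by apply: (fP (true :: s)); rewrite /= ?ss // add1n.
  apply/eqP; rewrite -oppr_eq0 -sub0r; apply/eqP.
  by apply: (fP (false :: s)); rewrite /= ?ss.
have [|f0 [f1 [fE f0d]]] := van_top (fun t => u * (l (c (true :: t)) - u * ga t)).
  move=> s ss sj; rewrite koszul_dZ koszul_dB koszul_dZ; apply: phi_ker.
  rewrite rmorphB rmorphM !phi_d !lift -c0E // -opprB.
  apply/eqP; rewrite oppr_eq0; apply/eqP.
  by apply: (dc (true :: s)); rewrite /= ?size_map ?ss // sj.
have [//|g0 [g1 [gE g0d]]] := van_top f0.
exists (fun s => match s with
  | true :: t => phi (g1 t) + eps (f1 t)
  | false :: t => eps (e0 t) + phi (g0 t)
  | [::] => 0 end).
move=> [|[] s] //=; rewrite size_map => -[ss] sj; rewrite koszul_dD.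
  rewrite add1n in sj.
  have /(congr1 eps) := fE s ss sj.
  rewrite /= eps_u [eps (_ - _)]raddfB eps_u gE // !rmorphB !rmorphM !lK !phi_d eps_d /= => E.
  by rewrite -[c _](subrK (phi u * eps (e0 s))) E; ring.
rewrite -phi_d g0d // raddf0 addr0 -c0E // subrr //.
Qed.

End Transfer.

(** * Maps out of the edge ring *)

Lemma kernel_is_ideal (A B : comNzRingType) (f : {rmorphism A -> B}) :
  is_ideal [set a | f a = 0].
Proof.
split=> [|a b fa fb|r a fa] /=; first by rewrite raddf0.
  by rewrite rmorphD fa fb addr0.
by rewrite rmorphM fa mulr0.
Qed.

Section EdgeRing.
Variables (k : fieldType) (H : sgraph).
Local Notation ER := (edge_ring k H).

Definition edge_class (p : vertex_ring k H) : ER :=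
  \pi_{ideal_quot (@edge_ideal k H)} p.

Lemma edge_class_is_zmod : zmod_morphism edge_class.
Proof. exact: (raddfB (\pi_{ideal_quot (@edge_ideal k H)})). Qed.
Lemma edge_class_is_monoid : monoid_morphism edge_class.
Proof.
split; first exact: (rmorph1 (\pi_{ideal_quot (@edge_ideal k H)})).
exact: (rmorphM (\pi_{ideal_quot (@edge_ideal k H)})).
Qed.
HB.instance Definition _ :=
  GRing.isZmodMorphism.Build (vertex_ring k H) ER edge_class edge_class_is_zmod.
HB.instance Definition _ :=
  GRing.isMonoidMorphism.Build (vertex_ring k H) ER edge_class edge_class_is_monoid.

Lemma edge_class_surj (a : ER) : exists p, edge_class p = a.
Proof. by exists (repr a); rewrite /edge_class reprK. Qed.

Lemma edge_class_eq p q :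
  edge_class p = edge_class q -> gen_ideal (@edge_monomials k H) (p - q).
Proof.
move=> /eqP; rewrite /edge_class -Quotient.idealrBE => pq.
by apply/asboolP; exact: pq.
Qed.

Lemma edge_class_eq0 p : gen_ideal (@edge_monomials k H) p -> edge_class p = 0.
Proof.
move=> pE; rewrite -(raddf0 edge_class); apply/eqP.
by rewrite /edge_class -Quotient.idealrBE subr0; apply/asboolP.
Qed.

Section Lift.
Variables (R : comNzRingType) (h : {rmorphism k -> R}) (f : H -> R).
Hypothesis f_edge : forall x y : H, adj x y -> f x * f y = 0.

Let pre : {rmorphism {mpoly k[#|H|]} -> R} := mmap h (fun i => f (enum_val i)).

Lemma pre_var x : pre (var k x) = f x.
Proof. by rewrite /pre /= mmapX mmap1U enum_rankK. Qed.

Lemma pre_edge p : gen_ideal (@edge_monomials k H) p -> pre p = 0.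
Proof.
apply: gen_ideal_min (kernel_is_ideal pre) _ p => _ [x [y [xy ->]]] /=.
by rewrite rmorphM !pre_var f_edge.
Qed.

Definition edge_lift (a : ER) : R := pre (repr a).

Lemma edge_liftE p : edge_lift (edge_class p) = pre p.
Proof.
apply/eqP; rewrite -subr_eq0 -raddfB; apply/eqP; apply: pre_edge.
by apply: edge_class_eq; rewrite /edge_class reprK.
Qed.

Lemma edge_lift_is_zmod : zmod_morphism edge_lift.
Proof.
move=> a b; have [[p <-] [q <-]] := (edge_class_surj a, edge_class_surj b).
by rewrite -raddfB !edge_liftE raddfB.
Qed.
Lemma edge_lift_is_monoid : monoid_morphism edge_lift.
Proof.
split; first by rewrite -(rmorph1 edge_class) edge_liftE rmorph1.
move=> a b; have [[p <-] [q <-]] := (edge_class_surj a, edge_class_surj b).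
by rewrite -rmorphM !edge_liftE rmorphM.
Qed.
HB.instance Definition _ :=
  GRing.isZmodMorphism.Build ER R edge_lift edge_lift_is_zmod.
HB.instance Definition _ :=
  GRing.isMonoidMorphism.Build ER R edge_lift edge_lift_is_monoid.

(** The edge ring is the universal algebra with elements indexed by the vertices
    whose products along the edges vanish. *)
Lemma edge_ring_lift : exists psi : {rmorphism ER -> R},
  (forall c, psi (edge_class c%:MP) = h c) /\
  (forall x, psi (edge_class (var k x)) = f x).
Proof.
exists edge_lift; split=> [c|x]; apply: (etrans (edge_liftE _)); last exact: pre_var.
exact: mmapC.
Qed.

End Lift.

Lemma edge_ring_ind (Q : ER -> Prop) :
  (forall c : k, Q (edge_class c%:MP)) -> (forall x, Q (edge_class (var k x))) ->
  (forall a b, Q a -> Q b -> Q (a + b)) -> (forall a b, Q a -> Q b -> Q (a * b)) ->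
  forall a, Q a.
Proof.
move=> QC QX QD QM a; have [p <-] := edge_class_surj a.
move: p; apply: mpoly_ind_gen => [//|i|p q Qp Qq|p q Qp Qq].
- by rewrite -(enum_valK i); apply: QX.
- by rewrite raddfD; apply: QD.
- by rewrite rmorphM; apply: QM.
Qed.

Lemma noetherian_edge_ring : noetherian ER.
Proof.
apply: (@noetherian_image _ _ edge_class edge_class_surj).
exact: noetherian_mpoly.
Qed.

(** Evaluation at the origin sends the irrelevant ideal to 0. *)
Lemma irrelevant_proper : ~ @irrelevant_ideal k H 1.
Proof.
have [|psi [psiC psiX]] := @edge_ring_lift k idfun (fun=> 0).
  by move=> x y _; rewrite mulr0.
move=> /(gen_ideal_min (kernel_is_ideal psi)) /= K.
have /eqP : psi 1 = 0 by apply: K => _ [x ->]; exact: (psiX x).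
by rewrite rmorph1 oner_eq0.
Qed.

End EdgeRing.

Arguments edge_class {k H} p.

(** * Comparing dimensions and depths *)

Section Suprema.

Lemma enat_sup_le (X Y : set nat) : X `<=` Y -> enat_le (enat_sup X) (enat_sup Y).
Proof.
move=> XY; rewrite /enat_sup.
have [[b Yb]|_] := asboolP (exists b, ubound Y b); last by case: ifP.
rewrite asboolT; last by exists b => x /XY; exact: Yb.
have [->|/set0P[x0 Xx0]] := eqVneq X set0; first by rewrite supremum0.
have Y0 : supremums Y !=set0 by apply: nat_supremums_neq0; exists b.
have X0 : supremums X !=set0.
  by apply: nat_supremums_neq0; exists b => x /XY; exact: Yb.
rewrite /enat_le /= {1}/supremum ifF; last by apply/eqP => XE; rewrite XE in Xx0.
case: xgetP => [x _ [_ xX]|nX]; last by case: X0 => x /nX.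
by apply: xX => y /XY; exact: ge_supremum_Nmem.
Qed.

Lemma enat_le_trans y x z : enat_le x y -> enat_le y z -> enat_le x z.
Proof. by case: x y z => [x|] [y|] [z|] //=; apply: leq_trans. Qed.

End Suprema.

Lemma krull_dim_surj (A B : comNzRingType) (phi : {rmorphism A -> B}) :
  (forall b, exists a, phi a = b) -> enat_le (krull_dim B) (krull_dim A).
Proof.
move=> phi_surj; apply: enat_sup_le => n [P [Pp Pc]].
exists (fun i a => phi a \in P i); split=> [i|i j ij].
  have [[P0 P1 PD] PM] := Pp i; split.
    split; rewrite ?unfold_in ?rmorph0 ?rmorph1 // => a x y.
    by rewrite !unfold_in rmorphD rmorphM; apply: PD.
  by move=> x y; rewrite !unfold_in rmorphM; apply: PM.
have [sPij nPji] := Pc i j ij; split=> [x|h]; first exact: sPij.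
by apply: nPji => b; have [a <-] := phi_surj b; apply: h.
Qed.

Lemma depth_transfer (A B : comNzRingType) (phi : {rmorphism A -> B})
    (eps : {additive A -> B}) (u : A) (xs : seq A) (m : set A) (m' : set B) :
  noetherian B -> (forall b, exists a, phi a = b) ->
  (forall a, phi a = 0 -> u * a = 0) ->
  {in xs, forall x a, eps (x * a) = phi x * eps a} ->
  (forall a, eps (u * a) = phi a) ->
  m `<=` gen_ideal [set` u :: xs] ->
  is_ideal m' -> ~ m' 1 -> {in u :: xs, forall x, m' (phi x)} ->
  enat_le (depth m) (depth m').
Proof.
move=> nB phi_surj phi_ker eps_lin eps_u mxs im' m'1 xm'.
apply: enat_sup_le => n [s [sn sm sr]].
apply: (@vanishing_regular B m' (map phi (u :: xs))) => //.
  by move=> _ /mapP[x /xm' ? ->].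
apply: (vanishing_transfer phi_surj phi_ker eps_lin eps_u); rewrite -sn.
apply: regular_vanishing => // a /sm.
exact: mxs.
Qed.

(** * Deleting the neighbour of a leaf *)

Section DeleteNeighbour.
Variables (k : fieldType) (G : sgraph) (u v : G).
Hypotheses (deg_u : degree u = 1%N) (uv : adj u v).

Local Notation H := (del_vertices [set v]%SET).
Local Notation A := (edge_ring k G).
Local Notation B := (edge_ring k H).
Local Notation xG x := (edge_class (var k (x : G))).
Local Notation xH x := (edge_class (var k (x : H))).

Lemma adj_leaf w : adj u w -> w = v.
Proof.
have /cards1P[z zE] : #|neighbours u| == 1%N by apply/eqP.
move=> uw; have : w \in neighbours u by rewrite inE.
have : v \in neighbours u by rewrite inE.
by rewrite zE !inE => /eqP-> /eqP.
Qed.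

Lemma u_notin : u \notin [set v]%SET.
Proof. by rewrite inE; apply: contraTneq uv => ->; rewrite adj_irrefl. Qed.

Let uH : H := Sub u u_notin.

Definition restrict (x : G) : B := if insub x is Some y then xH y else 0.

Lemma restrict_val (x : H) : restrict (val x) = xH x.
Proof. by rewrite /restrict valK. Qed.

Lemma restrict_v : restrict v = 0.
Proof. by rewrite /restrict insubF // inE eqxx. Qed.

Lemma edge_class_adj (F : sgraph) (x y : F) : adj x y ->
  edge_class (var k x) * edge_class (var k y) = 0.
Proof.
move=> xy; rewrite -rmorphM; apply: edge_class_eq0; apply: sub_gen_ideal.
by exists x, y.
Qed.

Lemma restrict_adj (x y : G) : adj x y -> restrict x * restrict y = 0.
Proof.
rewrite /restrict; case: insubP => [x' _ <-|_]; last by rewrite mul0r.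
case: insubP => [y' _ <-|_]; last by rewrite mulr0.
exact: (@edge_class_adj H).
Qed.

(** Sending u to the variable of a polynomial ring over B gives a map theta which
    records the powers of u, well defined since u lies on the single edge uv and v
    goes to 0.  Dropping the constant term and dividing by the variable before
    evaluating at u yields the map eps of the transfer theorem. *)
Theorem depth_delete_neighbour :
  enat_le (depth (@irrelevant_ideal k G)) (depth (@irrelevant_ideal k H)).
Proof.
pose c0 : {rmorphism k -> B} := edge_class \o (@mpolyC #|H| k).
have [|theta [thetaC thetaX]] := @edge_ring_lift k G {poly B} (polyC \o c0)
    (fun x => if x == u then 'X else (restrict x)%:P).
  move=> x y xy; have [xu|_] := eqVneq x u.
    have := xy; rewrite xu => /adj_leaf ->; rewrite ifF ?restrict_v ?mulr0 //.
    by apply/negbTE; apply: contraTneq uv => ->; rewrite adj_irrefl.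
  have [yu|_] := eqVneq y u; last by rewrite -rmorphM restrict_adj.
  have := xy; rewrite yu adj_sym => /adj_leaf ->.
  by rewrite restrict_v mul0r.
have [|sigma [sigmaC sigmaX]] := @edge_ring_lift k H A
    (edge_class \o (@mpolyC #|G| k)) (fun x => xG (val x)).
  by move=> x y xy; apply: (@edge_class_adj G).
pose phi : {rmorphism A -> B} := horner_eval (xH uH) \o theta.
pose eps : {additive A -> B} := horner_eval (xH uH) \o drop_poly 1 \o theta.
have phiC c : phi (edge_class c%:MP) = c0 c.
  by rewrite /phi /= thetaC /horner_eval hornerC.
have phiX x : phi (xG x) = restrict x.
  rewrite /phi /= thetaX /horner_eval; case: eqP => [->|_]; last exact: hornerC.
  by rewrite hornerX -restrict_val.
(* B embeds back into A, and a differs from its image in B by a multiple of v,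
   which u kills. *)
have phi_sigma b : phi (sigma b) = b.
  elim/edge_ring_ind: b => [c|x|a b IHa IHb|a b IHa IHb].
  - by rewrite sigmaC phiC.
  - by rewrite sigmaX phiX restrict_val.
  - by rewrite !rmorphD IHa IHb.
  - by rewrite !rmorphM IHa IHb.
have sigma_phi a : xG u * (a - sigma (phi a)) = 0.
  elim/edge_ring_ind: a => [c|x|a b IHa IHb|a b IHa IHb].
  - by rewrite phiC sigmaC subrr mulr0.
  - rewrite phiX; have [->|xv] := eqVneq x v.
      by rewrite restrict_v rmorph0 subr0 edge_class_adj.
    have xH0 : x \notin [set v]%SET by rewrite inE.
    by rewrite -[x]/(val (Sub x xH0 : H)) restrict_val sigmaX subrr mulr0.
  - rewrite !rmorphD (_ : _ * _ = xG u * (a - sigma (phi a)) + xG u * (b - sigma (phi b))).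
      by rewrite IHa IHb addr0.
    by ring.
  - rewrite !rmorphM (_ : _ * _ = xG u * (a - sigma (phi a)) * b +
        sigma (phi a) * (xG u * (b - sigma (phi b)))).
      by rewrite IHa IHb mul0r mulr0 addr0.
    by ring.
apply: (@depth_transfer A B phi eps (xG u) [seq xG x | x <- enum G & x != u]).
- exact: noetherian_edge_ring.
- by move=> b; exists (sigma b).
- by move=> a a0; rewrite -(sigma_phi a) a0 rmorph0 subr0.
- move=> _ /mapP[x + ->] a; rewrite mem_filter => /andP[/negbTE xu _].
  rewrite phiX /eps /= rmorphM thetaX xu mul_polyC drop_polyZ.
  by rewrite /horner_eval hornerZ.
- move=> a; rewrite /eps /phi /= rmorphM thetaX eqxx -commr_polyX.
  by rewrite -['X]expr1 drop_polyMXn_id.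
- apply: gen_ideal_min => [|_ [x ->]]; first exact: gen_ideal_is_ideal.
  apply: sub_gen_ideal; rewrite /= inE.
  have [->|xu] := eqVneq x u; first by rewrite eqxx.
  apply/orP; right; apply/mapP; exists x => //.
  by rewrite mem_filter xu mem_enum.
- exact: gen_ideal_is_ideal.
- exact: irrelevant_proper.
- have im := gen_ideal_is_ideal
      [set p | exists x : H, p = \pi_{ideal_quot (@edge_ideal k H)} (var k x)].
  have rm x : @irrelevant_ideal k H (restrict x).
    rewrite /restrict; case: insubP => [y _ _|_]; last exact: ideal0.
    by apply: sub_gen_ideal; exists y.
  move=> x; rewrite inE => /predU1P[->|/mapP[y _ ->]]; rewrite phiX; exact: rm.
Qed.

Theorem krull_dim_delete_neighbour : enat_le (krull_dim B) (krull_dim A).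
Proof.
have [|phi [phiC phiX]] := @edge_ring_lift k G B (edge_class \o (@mpolyC #|H| k)) restrict.
  exact: restrict_adj.
apply: (@krull_dim_surj _ _ phi).
elim/edge_ring_ind => [c|x|_ _ [a <-] [b <-]|_ _ [a <-] [b <-]].
- by exists (edge_class c%:MP); rewrite phiC.
- by exists (xG (val x)); rewrite phiX restrict_val.
- by exists (a + b); rewrite rmorphD.
- by exists (a * b); rewrite rmorphM.
Qed.

End DeleteNeighbour.

Theorem corollary2p4 (k : fieldType) (G : sgraph) (u v : G) :
  no_isolated_vertex G -> bipartite G -> almost_CM k G ->
  degree u = 1%N -> adj u v ->
  almost_CM k (del_vertices [set v]%SET).
Proof.
move=> _ _ aCM deg_u uv.
apply: (enat_le_trans (krull_dim_delete_neighbour k v)).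
apply: (enat_le_trans aCM); have := depth_delete_neighbour k deg_u uv.
by case: (depth _) (depth _) => [a|] [b|].
Qed.
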